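(* Let $(T,R)$ be a problem instance with $n\ge 1$ unit-weight tasks and $m$ resources with delays $d_1\le\dots\le d_m$. The algorithm FindOpt, defined as follows, constructs a lowest-cost assignment for $(T,R)$ in $O(nm)$ time. FindOpt$(T,R)$: (1) Set $n_i=0$ for $i=1,\dots,m$. (2) For $\tau=1,\dots,n$: (a) choose a resource $k$ so as to minimize $(2n_k+1)d_k$; (b) increment $n_k$. (3) Return $\overline{n}=\langle n_1,\dots,n_m\rangle$.
   Context: There are $m$ resources with positive real delays $d_1\le\dots\le d_m$ and $n$ tasks, each of weight $1$. An assignment is represented by $\overline{n}=\langle n_1,\dots,n_m\rangle$ with nonnegative integers $n_\ell$ summing to $n$, where $n_\ell$ is the number of tasks assigned to resource $\ell$. Its (social) cost is $C(\overline{n})=\sum_{\ell=1}^m n_\ell^2 d_\ell$ (the sum over tasks of the load $n_\ell d_\ell$ of the resource used). A lowest-cost assignment is one minimizing $C$ over all assignments. Running time counts elementary arithmetic operations and comparisons. Ties in step (2a) may be broken arbitrarily. *)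

(* Defs.v *)
From mathcomp Require Import all_boot all_order all_algebra.
From mathcomp Require Import reals.

Set Implicit Arguments.
Unset Strict Implicit.
Unset Printing Implicit Defensive.

Import Order.TTheory GRing.Theory Num.Theory.

Local Open Scope ring_scope.

(* [counts m] lists the numbers n_1, ..., n_m of tasks per resource; the
   resources are indexed from 0. *)
Definition counts (m : nat) := {ffun 'I_m -> nat}.

Definition is_assignment (m n : nat) (nbar : counts m) : Prop :=
  (\sum_(l < m) nbar l)%N = n.

Definition cost (R : realType) (m : nat) (d : 'I_m -> R) (nbar : counts m) : R :=
  \sum_(l < m) (nbar l)%:R ^+ 2 * d l.

Definition lowest_cost (R : realType) (m n : nat) (d : 'I_m -> R)
    (nbar : counts m) : Prop :=
  is_assignment n nbar /\
  forall nbar' : counts m, is_assignment n nbar' -> cost d nbar <= cost d nbar'.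

Definition key (R : realType) (m : nat) (d : 'I_m -> R) (nbar : counts m)
    (k : 'I_m) : R :=
  (2 * nbar k + 1)%:R * d k.

Definition minimizes_key (R : realType) (m : nat) (d : 'I_m -> R)
    (nbar : counts m) (k : 'I_m) : Prop :=
  forall l : 'I_m, key d nbar k <= key d nbar l.

Definition set_count (m : nat) (nbar : counts m) (k : 'I_m) (x : nat) : counts m :=
  [ffun l => if l == k then x else nbar l].

(* [FindOpt d n nbar]: FindOpt can return nbar on n tasks. It is a relation
   because any minimizer may be chosen in step (2a). *)
Inductive FindOpt (R : realType) (m : nat) (d : 'I_m -> R) :
    nat -> counts m -> Prop :=
| FindOpt_init : FindOpt d 0 [ffun => 0%N]
| FindOpt_step (tau : nat) (nbar : counts m) (k : 'I_m) :
    FindOpt d tau nbar -> minimizes_key d nbar k ->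
    FindOpt d tau.+1 (set_count nbar k (nbar k).+1).

(* Nondeterministic computations with operation counting: [p a t] means that
   some execution of p returns a after exactly t elementary operations. *)
Definition timed (A : Type) := A -> nat -> Prop.

Definition ret (A : Type) (a : A) : timed A := fun b t => b = a /\ t = 0%N.

Definition bind (A B : Type) (p : timed A) (f : A -> timed B) : timed B :=
  fun b t => exists a t1 t2, [/\ p a t1, f a b t2 & t = (t1 + t2)%N].

Notation "'let!' x ':=' p 'in' q" := (bind p (fun x => q))
  (at level 200, x name, p at level 100, q at level 200).

Definition fail (A : Type) : timed A := fun _ _ => False.

Definition charge (n : nat) (A : Type) (a : A) : timed A :=
  fun b t => b = a /\ t = n.

(* Unit-cost primitives. Besides arithmetic and comparisons, array reads and
   assignments are charged as well. *)
Definition op_addn (x y : nat) : timed nat := charge 1 (x + y)%N.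
Definition op_muln (x y : nat) : timed nat := charge 1 (x * y)%N.
Definition op_mulr (R : realType) (x y : R) : timed R := charge 1 (x * y).
Definition op_read (m : nat) (A : Type) (a : 'I_m -> A) (k : 'I_m) : timed A :=
  charge 1 (a k).
Definition op_write (m : nat) (nbar : counts m) (k : 'I_m) (x : nat) :
    timed (counts m) :=
  charge 1 (set_count nbar k x).

(* One comparison, strict or not: on a tie both answers are possible. *)
Definition op_better (R : realType) (v w : R) : timed bool :=
  fun b t => (b = (v < w) \/ b = (v <= w)) /\ t = 1%N.

(* An array with arbitrary initial contents. *)
Definition alloc (m : nat) : timed (counts m) := fun _ t => t = 0%N.

(* A for-loop over s with state x. Each iteration pays for one test and one
   increment of the loop counter, and exiting pays for the last test. *)
Fixpoint for_loop (I S : Type) (s : seq I) (body : I -> S -> timed S) (x : S) :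
    timed S :=
  if s is i :: s' then
    let! _ := charge 2 tt in
    let! y := body i x in
    for_loop s' body y
  else charge 1 x.

Definition compute_key (R : realType) (m : nat) (d : 'I_m -> R)
    (nbar : counts m) (k : 'I_m) : timed R :=
  let! x := op_read nbar k in
  let! y := op_muln 2 x in
  let! z := op_addn y 1 in
  let! w := op_read d k in
  op_mulr z%:R w.

(* Step (2a) by a linear scan; the state is the best resource so far and its
   key, so that updating it is two assignments. *)
Definition select (R : realType) (m : nat) (d : 'I_m -> R) (nbar : counts m) :
    timed 'I_m :=
  if enum 'I_m is k0 :: ks then
    let! v0 := compute_key d nbar k0 in
    let! init := charge 2 (k0, v0) in
    let! best := for_loop ks (fun k cur =>
      let! v := compute_key d nbar k in
      let! b := op_better v cur.2 in
      if b then charge 2 (k, v) else ret cur) init in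
    ret best.1
  else fail (A := 'I_m).

Definition FindOpt_prog (R : realType) (m : nat) (d : 'I_m -> R) (n : nat) :
    timed (counts m) :=
  let! nbar0 := @alloc m in
  let! nbar1 := for_loop (enum 'I_m) (fun i nbar => op_write nbar i 0) nbar0 in
  for_loop (iota 1 n) (fun _ nbar =>
    let! k := select d nbar in
    let! x := op_read nbar k in
    let! y := op_addn x 1 in
    op_write nbar k y) nbar1.

(* Main.v *)
(* The greedy keys produce a Lagrange multiplier: after every step there is a
   lambda with (2 n_l - 1) d_l <= lambda <= (2 n_l + 1) d_l for all l, namely
   the last minimal key. By convexity, x^2 d_l >= n_l^2 d_l + lambda (x - n_l)
   for every natural number x, and summing over l cancels the lambda terms for
   two assignments of the same tasks. *)
Require Import Defs.
From mathcomp Require Import all_boot all_order all_algebra.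
From mathcomp Require Import reals.
From mathcomp Require Import zify lra.

Set Implicit Arguments.
Unset Strict Implicit.
Unset Printing Implicit Defensive.

Import Order.TTheory GRing.Theory Num.Theory.

Local Open Scope ring_scope.

(** * Optimality of the greedy choices *)

Section Greedy.
Variables (R : realType) (m : nat) (d : 'I_m -> R).

(** The bounds are the marginal costs of the last and of the next task on [l]. The subtraction is in
    [R], so an empty resource has lower bound [- d l]. *)
Definition multiplier (nbar : counts m) (lambda : R) : Prop :=
  forall l, ((nbar l)%:R * 2 - 1) * d l <= lambda <= ((nbar l)%:R * 2 + 1) * d l.

Lemma keyE (nbar : counts m) k : key d nbar k = ((nbar k)%:R * 2 + 1) * d k.
Proof. by rewrite /key natrD natrM [_ * 2]mulrC. Qed.

Lemma FindOpt_assignment n nbar : FindOpt d n nbar -> is_assignment n nbar.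
Proof.
elim=> [|tau {}nbar k _ IH _]; rewrite /is_assignment.
  by rewrite big1 // => l _; rewrite ffunE.
rewrite -IH (bigD1 k) //= [in RHS](bigD1 k) //= ffunE eqxx addSn; congr (_ + _).+1.
by apply: eq_bigr => l /negPf lk; rewrite ffunE lk.
Qed.

Lemma FindOpt_multiplier n nbar : (forall l, 0 <= d l) ->
  FindOpt d n nbar -> exists lambda, multiplier nbar lambda.
Proof.
move=> d0; elim=> [|tau {}nbar k _ [lambda IH] kmin].
  by exists 0 => l; rewrite ffunE mul0r sub0r add0r; have := d0 l; lra.
(* The chosen key becomes the lower bound at [k]. Elsewhere minimality puts it below the upper
   bound, and it is above the lower one because it is at least the old [lambda]. *)
exists (key d nbar k) => l; have := kmin l; have := kmin k.
rewrite ffunE !keyE; case: eqP => [->|_] _ kl.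
  have := d0 k; rewrite -natr1; set X := (nbar k)%:R => dk.
  by apply/andP; split; nra.
by move: (IH k) (IH l) => /andP[_ hk] /andP[hl _]; lra.
Qed.

(** With [h = y - x], [y^2 - x^2] equals both [(2x + 1) h + h (h - 1)] and [(2x - 1) h + h (h + 1)];
    the remainders are nonnegative for integral [h]. The first form serves [h > 0], the second
    [h < 0]. *)
Lemma square_tangent (a lambda : R) (x y : nat) : 0 <= a ->
  (x%:R * 2 - 1) * a <= lambda <= (x%:R * 2 + 1) * a ->
  x%:R ^+ 2 * a + lambda * (y%:R - x%:R) <= y%:R ^+ 2 * a.
Proof.
move=> a0 /andP[lo hi]; case: (ltngtP x y) => [xy|yx|->]; last by lra.
- have : x%:R + 1 <= y%:R :> R by rewrite natr1 ler_nat.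
  move: x%:R y%:R hi {lo} => X Y hi XY.
  have [YX YX1] : 0 <= Y - X /\ 0 <= Y - X - 1 by split; lra.
  by have := ler_wpM2r YX hi; have := mulr_ge0 a0 (mulr_ge0 YX YX1); lra.
- have : y%:R + 1 <= x%:R :> R by rewrite natr1 ler_nat.
  move: x%:R y%:R lo {hi} => X Y lo XY.
  have [YX YX1] : 0 <= X - Y /\ 0 <= X - Y - 1 by split; lra.
  by have := ler_wpM2r YX lo; have := mulr_ge0 a0 (mulr_ge0 YX YX1); lra.
Qed.

Lemma multiplier_lowest_cost n nbar lambda : (forall l, 0 <= d l) ->
  is_assignment n nbar -> multiplier nbar lambda -> lowest_cost n d nbar.
Proof.
move=> d0 nbarn lam; split=> // nbar' nbar'n.
have -> : cost d nbar =
    \sum_(l < m) ((nbar l)%:R ^+ 2 * d l + lambda * ((nbar' l)%:R - (nbar l)%:R)).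
  rewrite big_split /= -mulr_sumr sumrB -!natr_sum.
  by rewrite [X in X%:R - _]nbar'n [X in _ - X%:R]nbarn subrr mulr0 addr0.
by apply: ler_sum => l _; exact: square_tangent.
Qed.

Lemma FindOpt_total n : (0 < m)%N -> exists nbar, FindOpt d n nbar.
Proof.
move=> m0; elim: n => [|n [nbar IH]]; first by exists [ffun => 0%N]; constructor.
pose k := [arg min_(k < Ordinal m0) key d nbar k]%O.
exists (set_count nbar k (nbar k).+1); constructor=> //.
by rewrite /k; case: arg_minP => // j _ jmin l; exact: jmin.
Qed.

End Greedy.

(** * Loop rules for timed nondeterministic computations *)

Section ForLoop.
Variables (I S : Type) (body : I -> S -> timed S).

(** [P] is indexed by the iterations still to come. Each round adds 2 operations of loop overhead to
    [c], and the exit test adds 1. *)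
Lemma for_loop_inv (P : seq I -> S -> Prop) c :
  (forall i s x y t, P (i :: s) x -> body i x y t -> P s y /\ (t <= c)%N) ->
  forall s x y t, P s x -> for_loop s body x y t ->
    P [::] y /\ (t <= c.+2 * size s + 1)%N.
Proof.
move=> step; elim=> [|i s IH] x y t Px /=.
  by case=> -> ->; rewrite muln0.
case=> [_ [_ [_ [[_ ->] [z [t1 [t2 [xz zy ->]]]] ->]]]].
have [Pz t1c] := step _ _ _ _ _ Px xz.
by have [Py t2c] := IH _ _ _ Pz zy; split=> //; lia.
Qed.

(** Existential counterpart: the invariant steers the choices of one execution. *)
Lemma for_loop_run (P : seq I -> S -> Prop) :
  (forall i s x, P (i :: s) x -> exists y t, body i x y t /\ P s y) ->
  forall s x, P s x -> exists y t, for_loop s body x y t /\ P [::] y.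
Proof.
move=> step; elim=> [|i s IH] x Px /=; first by exists x, 1%N.
have [z [t1 [xz Pz]]] := step _ _ _ Px; have [y [t2 [zy Py]]] := IH _ Pz.
exists y, (2 + (t1 + t2))%N; split=> //; exists tt, 2, (t1 + t2)%N; split=> //.
by exists z, t1, t2.
Qed.

(** Loops unfold at the front, whereas [FindOpt] adds its steps at the end. *)
Lemma for_loop_rcons s i x y z t t' :
  for_loop s body x y t -> body i y z t' ->
  exists u, for_loop (rcons s i) body x z u.
Proof.
move=> + yz; elim: s x t => [|j s IH] x t /=.
  case=> <- _; exists (2 + (t' + 1))%N, tt, 2, (t' + 1)%N; split=> //.
  by exists z, t', 1%N.
case=> [_ [_ [_ [_ [w [t1 [t2 [xw /IH[u wz] _]]]] _]]]].
by exists (2 + (t1 + u))%N, tt, 2, (t1 + u)%N; split=> //; exists w, t1, u.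
Qed.

End ForLoop.

(** * Selection of a minimal key by a scan *)

Section Program.
Variables (R : realType) (m : nat) (d : 'I_m -> R).

Lemma compute_keyP nbar k v t :
  compute_key d nbar k v t <-> v = key d nbar k /\ t = 5.
Proof.
split.
  by case=> [_ [_ [_ [[-> ->] [_ [_ [_ [[-> ->] [_ [_ [_ [[-> ->]
    [_ [_ [_ [[-> ->] [-> ->] ->]]]] ->]]]] ->]]]] ->]]]].
case=> -> ->; exists (nbar k), 1%N, 4; split=> //.
exists (2 * nbar k)%N, 1%N, 3; split=> //.
exists (2 * nbar k + 1)%N, 1%N, 2; split=> //.
by exists (d k), 1%N, 1%N.
Qed.

Definition scan_step (nbar : counts m) (k : 'I_m) (cur : 'I_m * R) :
    timed ('I_m * R) :=
  let! v := compute_key d nbar k in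
  let! b := op_better v cur.2 in
  if b then charge 2 (k, v) else ret cur.

(** The cost is 5 for the key, 1 for the comparison and at most 2 for the update. Both outcomes
    carry a weak inequality, since a tie can go either way. *)
Lemma scan_stepP nbar k cur cur' t : scan_step nbar k cur cur' t ->
  (t <= 8)%N /\
  (cur' = (k, key d nbar k) /\ key d nbar k <= cur.2 \/
   cur' = cur /\ cur.2 <= key d nbar k).
Proof.
case=> [_ [_ [_ [/compute_keyP[-> ->] [b [_ [t2 [[bE ->] + ->]]]] ->]]]].
case: b bE => bE [-> ->]; split=> //; [left|right]; split=> //.
  by case: bE => /esym // /ltW.
by case: bE => /esym/negbT; rewrite -?leNgt -?ltNge // => /ltW.
Qed.

Lemma scan_step_run nbar k cur (b : bool) :
  b = (key d nbar k < cur.2) \/ b = (key d nbar k <= cur.2) ->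
  exists t, scan_step nbar k cur (if b then (k, key d nbar k) else cur) t.
Proof.
move=> bE; pose t := if b then 2 else 0%N.
exists (5 + (1 + t))%N, (key d nbar k), 5, (1 + t)%N; split=> //.
  exact/compute_keyP.
by exists b, 1%N, t; split=> //; rewrite /t; case: b {bE t}.
Qed.

Lemma select_sound nbar k t :
  select d nbar k t -> minimizes_key d nbar k /\ (t <= 10 * m)%N.
Proof.
rewrite /select; have := size_enum_ord m; have := mem_enum 'I_m.
case: (enum 'I_m) => // k0 ks ksP /= ksm.
case=> [_ [_ [_ [/compute_keyP[-> ->]
  [_ [_ [_ [[-> ->] [best [t1 [_ [scan [-> ->] ->]]]] ->]]]] ->]]]].
(* The list [s] holds the resources not yet scanned, so the current key is minimal among the scanned
   ones. *)
pose P (s : seq 'I_m) (cur : 'I_m * R) :=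
  cur.2 = key d nbar cur.1 /\ forall l, l \notin s -> cur.2 <= key d nbar l.
have step i s x y u : P (i :: s) x -> scan_step nbar i x y u -> P s y /\ (u <= 8)%N.
  move=> [xE xmin] /scan_stepP[u8 yE]; split=> //.
  case: yE => [[-> le_ix]|[-> le_xi]]; split=> //= l ls;
    have [->//|li] := eqVneq l i.
    by apply: le_trans le_ix _; apply: xmin; rewrite inE negb_or li.
  by apply: xmin; rewrite inE negb_or li.
have P0 : P ks (k0, key d nbar k0).
  split=> //= l; have := ksP l; rewrite !inE => /orP[/eqP-> //|-> //].
have [[bestE bestmin] t1c] := for_loop_inv step P0 scan.
(* The first key and its assignments cost 7, the loop at most [10 (m - 1) + 1]. *)
by split; [move=> l; rewrite -bestE; exact: bestmin | lia].
Qed.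

(* To end at a given minimizer, ties are resolved against every other
   resource. *)
Lemma select_complete nbar k :
  minimizes_key d nbar k -> exists t, select d nbar k t.
Proof.
move=> kmin; rewrite /select; have := mem_enum 'I_m.
case: (enum 'I_m) => [/(_ k)//|k0 ks ksP].
pose P (s : seq 'I_m) (cur : 'I_m * R) :=
  cur.2 = key d nbar cur.1 /\ (k \notin s -> cur.1 = k).
have step i s x : P (i :: s) x -> exists y u, scan_step nbar i x y u /\ P s y.
  move=> [xE xk].
  (* The weak test lets [k] displace an equal key; the strict one keeps an equal key from displacing
     [k]. *)
  pose b := if i == k then key d nbar i <= x.2 else key d nbar i < x.2.
  have [|u stepu] := @scan_step_run nbar i x b.
    by rewrite /b; case: eqP; [right | left].
  exists (if b then (i, key d nbar i) else x), u; split=> //.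
  rewrite /b; have [->|ik] := eqVneq i k; first by rewrite xE kmin.
  split; first by case: ifP.
  move=> ks'; have xk' : x.1 = k by apply: xk; rewrite inE negb_or eq_sym ik.
  by rewrite xE xk' ltNge kmin.
have P0 : P ks (k0, key d nbar k0).
  split=> //= kks; have := ksP k; rewrite !inE (negPf kks) orbF.
  by move=> /eqP.
have [best [t [scan [_ bestk]]]] := for_loop_run step P0.
exists (5 + (2 + (t + 0)))%N, (key d nbar k0), 5, (2 + (t + 0))%N.
split=> //; first exact/compute_keyP.
exists (k0, key d nbar k0), 2, (t + 0)%N; split=> //.
by exists best, t, 0%N; split=> //; split=> //; rewrite bestk.
Qed.

(** * Initialization of the counts *)

Definition clear_step (i : 'I_m) (nbar : counts m) : timed (counts m) :=
  op_write nbar i 0.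

(** Loop invariant with [s] the entries still to be written; for the full enumeration it holds
    vacuously, whatever the initial contents. *)
Definition cleared (s : seq 'I_m) (nbar : counts m) : Prop :=
  forall l, l \notin s -> nbar l = 0%N.

Lemma cleared_step i s nbar :
  cleared (i :: s) nbar -> cleared s (set_count nbar i 0).
Proof.
move=> H l ls; rewrite ffunE; case: eqP => // /eqP li.
by apply: H; rewrite inE negb_or li.
Qed.

Lemma cleared_enum nbar : cleared (enum 'I_m) nbar.
Proof. by move=> l; rewrite mem_enum. Qed.

Lemma cleared_nil nbar : cleared [::] nbar -> nbar = [ffun => 0%N].
Proof. by move=> H; apply/ffunP => l; rewrite ffunE H. Qed.

Lemma clear_sound nbar0 nbar t :
  for_loop (enum 'I_m) clear_step nbar0 nbar t ->
  nbar = [ffun => 0%N] /\ (t <= 3 * m + 1)%N.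
Proof.
have step i s x y u : cleared (i :: s) x -> clear_step i x y u ->
    cleared s y /\ (u <= 1)%N.
  by move=> /cleared_step H [-> ->].
case/(for_loop_inv step (@cleared_enum nbar0)) => /cleared_nil ->.
by rewrite size_enum_ord.
Qed.

Lemma clear_run nbar0 :
  exists t, for_loop (enum 'I_m) clear_step nbar0 [ffun => 0%N] t.
Proof.
have step i s x : cleared (i :: s) x ->
    exists y u, clear_step i x y u /\ cleared s y.
  by move=> /cleared_step H; exists (set_count x i 0), 1%N.
have [y [t [run /cleared_nil y0]]] := for_loop_run step (@cleared_enum nbar0).
by exists t; rewrite -y0.
Qed.

(** * Assignment of one task, and the whole program *)

Definition assign_step (_ : nat) (nbar : counts m) : timed (counts m) :=
  let! k := select d nbar in
  let! x := op_read nbar k in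
  let! y := op_addn x 1 in
  op_write nbar k y.

Lemma assign_step_sound i nbar nbar' t : assign_step i nbar nbar' t ->
  (exists2 k, minimizes_key d nbar k & nbar' = set_count nbar k (nbar k).+1) /\
  (t <= 10 * m + 3)%N.
Proof.
case=> [k [t1 [_ [/select_sound[kmin t1m] [_ [_ [_ [[-> ->]
  [_ [_ [_ [[-> ->] [-> ->] ->]]]] ->]]]] ->]]]].
by split; [exists k; rewrite ?addn1 | rewrite leq_add].
Qed.

Lemma assign_step_complete i nbar k : minimizes_key d nbar k ->
  exists t, assign_step i nbar (set_count nbar k (nbar k).+1) t.
Proof.
case/select_complete=> t sel; exists (t + 3)%N, k, t, 3; split=> //.
exists (nbar k), 1%N, 2; split=> //.
by exists (nbar k + 1)%N, 1%N, 1%N; split=> //; rewrite addn1.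
Qed.

(** Clearing costs at most [3m + 1]; each of the [n] rounds costs at most [10m + 3] plus 2 for the
    loop, and the final test 1. *)
Lemma FindOpt_prog_sound n nbar t : FindOpt_prog d n nbar t ->
  FindOpt d n nbar /\ (t <= (10 * m + 5) * n + 3 * m + 2)%N.
Proof.
case=> [nbar0 [_ [_ [-> [_ [t1 [t2 [/clear_sound[-> t1m] run ->]]]] ->]]]].
pose P (s : seq nat) (nb : counts m) :=
  exists2 tau, FindOpt d tau nb & (tau + size s)%N = n.
have step i s x y u : P (i :: s) x -> assign_step i x y u ->
    P s y /\ (u <= 10 * m + 3)%N.
  move=> [tau opt taun] /assign_step_sound[[k kmin ->] um]; split=> //.
  by exists tau.+1; [constructor | rewrite -taun addSnnS].
have P0 : P (iota 1 n) [ffun => 0%N].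
  by exists 0%N; [constructor | rewrite size_iota].
have [[tau opt /=]] := for_loop_inv step P0 run.
by rewrite addn0 size_iota => taun t2n; split; [rewrite -taun | lia].
Qed.

Lemma FindOpt_prog_complete n nbar :
  FindOpt d n nbar -> exists t, FindOpt_prog d n nbar t.
Proof.
move=> opt.
have [t2 run] : exists t,
    for_loop (iota 1 n) assign_step [ffun => 0%N] nbar t.
  elim: opt => [|tau {}nbar k _ [t run] /(assign_step_complete (1 + tau))[t' last]].
    by exists 1%N.
  by rewrite -[tau.+1]addn1 iotaD cats1; exact: for_loop_rcons run last.
have [t1 clear] := clear_run [ffun => 0%N].
(* Any initial contents would do, as they are overwritten; zeros are a convenient choice. *)
exists (0 + (t1 + t2))%N, [ffun => 0%N], 0%N, (t1 + t2)%N; split=> //.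
by exists [ffun => 0%N], t1, t2.
Qed.

End Program.

Theorem theorem4p2 (R : realType) :
  exists c : nat,
  forall (m n : nat) (d : 'I_m -> R),
    (0 < m)%N -> (0 < n)%N ->
    (forall i : 'I_m, 0 < d i) ->
    (forall i j : 'I_m, (i <= j)%N -> d i <= d j) ->
    [/\ forall nbar : counts m, FindOpt d n nbar -> lowest_cost n d nbar,
        forall nbar : counts m,
          FindOpt d n nbar <-> exists t : nat, FindOpt_prog d n nbar t,
        exists (nbar : counts m) (t : nat), FindOpt_prog d n nbar t &
        forall (nbar : counts m) (t : nat),
          FindOpt_prog d n nbar t -> (t <= c * (n * m))%N].
Proof.
(* As [m] and [n] are at least 1, [10mn + 5n + 3m + 2] is at most [(10 + 5 + 3 + 2) mn]. *)
exists 20 => m n d m0 n0 d0 _; have d0' l : 0 <= d l by exact: ltW.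
split.
- move=> nbar opt; have [lambda lam] := FindOpt_multiplier d0' opt.
  exact: multiplier_lowest_cost d0' (FindOpt_assignment opt) lam.
- move=> nbar; split; first exact: FindOpt_prog_complete.
  by case=> t /FindOpt_prog_sound[].
- have [nbar opt] := FindOpt_total d n m0.
  by have [t run] := FindOpt_prog_complete opt; exists nbar, t.
- by move=> nbar t /FindOpt_prog_sound[_ tm]; nia.
Qed.
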